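(* Consider a finite episodic MDP $(\mathcal S,\mathcal A,P,r,\gamma)$ with $|\mathcal S\times\mathcal A|<\infty$, deterministic reward function $r(s,a)$, discount factor $\gamma\in[0,1)$, in which every episode ends upon reaching a terminal state (whose value is defined to be $0$). Assume the transition function is fully deterministic: $P(s'\mid s,a)=\delta(s'=f(s,a))$ for some function $f$. Run the tabular GEM algorithm (described in the context) with learning rates $\alpha_t(s,a)\in(0,1)$ satisfying, with probability one, $\sum_t\alpha_t(s,a)=\infty$ and $\sum_t\alpha_t^2(s,a)<\infty$ for all $(s,a)$. Then both tables $Q^{(1)}$ and $Q^{(2)}$ converge to the optimal action-value function $Q^*$ with probability one.
   Context: Tabular GEM algorithm: maintain two tables $Q^{(1)},Q^{(2)}:\mathcal S\times\mathcal A\to\mathbb R$, arbitrarily initialized. In each episode the agent acts with an $\epsilon$-greedy policy ($\epsilon>0$ fixed) with respect to the current table $Q^{(1)}$ (or $Q^{(2)}$), producing a trajectory $(s_0,a_0,r_0,\dots,s_T,a_T,r_T)$ followed by termination. After the episode ends, for $t=0,1,\dots,T$ in order, using the current tables: for $i\in\{1,2\}$ define, for $k\ge t$ and $h\ge 0$, $V^{(i)}_{k,0}=\max_{a}Q^{(i)}(s_k,a)$ for $k\le T$, $V^{(i)}_{k,h}=r_k+\gamma V^{(i)}_{k+1,h-1}$ for $h>0$, and $V^{(i)}_{k,h}=0$ for $k>T$; let $h^*_{(i)}\in\arg\max_{h>0}V^{(i)}_{t,h}$ (fixed tie-breaking) and $R^{(i)}_t=V^{(j)}_{t,h^*_{(i)}}$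 where $j\ne i$. Then choose $i\in\{1,2\}$ uniformly at random and update $Q^{(i)}(s_t,a_t)\leftarrow Q^{(i)}(s_t,a_t)+\alpha_t(s_t,a_t)\big(R^{(i)}_t-Q^{(i)}(s_t,a_t)\big)$; entries not updated at a step are unchanged (equivalently $\alpha_t(s,a)=0$ there). $Q^*$ is the unique solution of $Q^*(s,a)=r(s,a)+\gamma\sum_{s'}P(s'|s,a)\max_{a'}Q^*(s',a')$, with value $0$ at terminal states. *)

(* Defs.v *)
From HB Require Import structures.
From mathcomp Require Import all_boot all_order all_algebra.
From mathcomp Require Import all_classical all_reals all_analysis.
Set Implicit Arguments. Unset Strict Implicit. Unset Printing Implicit Defensive.
Import Order.TTheory GRing.Theory Num.Theory.
Local Open Scope ring_scope.

(* One elementary random draw consumed by the algorithm at each "tick":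
   (explore?, uniformly random action, fair coin for the table to update,
    sample of the start-state distribution). *)
Definition Draw (S A : finType) := (bool * A * bool * S)%type.

Definition d_explore (S A : finType) (d : Draw S A) : bool := d.1.1.1.
Definition d_action  (S A : finType) (d : Draw S A) : A := d.1.1.2.
Definition d_coin    (S A : finType) (d : Draw S A) : bool := d.1.2.
Definition d_start   (S A : finType) (d : Draw S A) : S := d.2.

(* law of one draw: explore ~ Bernoulli(eps), action ~ Uniform(A),
   coin ~ Bernoulli(1/2), start ~ mu, all independent *)
Definition pdraw (R : realType) (S A : finType) (eps : R) (mu : S -> R)
  (d : Draw S A) : R :=
  (if d_explore d then eps else 1 - eps) * (#|A|%:R)^-1 * 2^-1 * mu (d_start d).

(* Phase of the algorithm:
   Begin            : a new episode is about to start;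
   Act tr s b       : inside an episode, trajectory so far tr (state-action
                      pairs, in order), current nonterminal state s, acting
                      greedily w.r.t. Q1 if b, Q2 otherwise;
   Upd tr t         : episode tr finished, now performing the update for t. *)
Inductive phase (S A : Type) :=
| Begin
| Act of seq (S * A) & S & bool
| Upd of seq (S * A) & nat.
Arguments Begin {S A}.

Record cfg (R : Type) (S A : Type) := Cfg {
  cQ1 : S -> A -> R; cQ2 : S -> A -> R; cph : phase S A }.

Section GEM.
Variables (R : realType) (S A : finType).
Variable a0 : A.
(* terminal states are encoded by [None]; S is the set of nonterminal states *)
Variable f : S -> A -> option S.
Variable r : S -> A -> R.
Variable gamma : R.

Definition maxOverA (F : A -> R) : R := \big[Num.max/F a0]_(a : A) F a.

(* V_{k,h} computed on the suffix (s_k,a_k),...,(s_T,a_T) of the trajectory;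
   the empty suffix corresponds to k > T (value 0). *)
Fixpoint Vgem (Q : S -> A -> R) (suf : seq (S * A)) (h : nat) : R :=
  match h, suf with
  | 0, (s, _) :: _ => maxOverA (Q s)
  | 0, [::] => 0
  | h'.+1, (s, a) :: rest => r s a + gamma * Vgem Q rest h'
  | _.+1, [::] => 0
  end.

(* For the suffix starting at t, V_{t,h} is constant for h >= size suf, so
   argmax_{h>0} can be taken among h = 1 .. size suf. *)
Definition Vlist (Q : S -> A -> R) (suf : seq (S * A)) : seq R :=
  [seq Vgem Q suf h.+1 | h <- iota 0 (size suf)].

(* hsel : tie-breaking selector of an argmax index in a list of reals *)
Variable hsel : seq R -> nat.
(* gsel : tie-breaking greedy action selector *)
Variable gsel : (A -> R) -> A.

Definition hstar (Q : S -> A -> R) (suf : seq (S * A)) : nat :=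
  (hsel (Vlist Q suf)).+1.

Definition gem_target (Qi Qj : S -> A -> R) (suf : seq (S * A)) : R :=
  Vgem Qj suf (hstar Qi suf).

Definition upd_at (Q : S -> A -> R) (s : S) (a : A) (v : R) : S -> A -> R :=
  fun s' a' => if (s' == s) && (a' == a) then v else Q s' a'.

(* start-state rule, acting-table rule, learning-rate rule: arbitrary
   non-anticipating functions of the past draws (and of the current draw for
   the start/table rules, whose draw is not otherwise used). *)
Variable start : seq (Draw S A) -> Draw S A -> S.
Variable tabrule : seq (Draw S A) -> Draw S A -> bool.
Variable alpha : seq (Draw S A) -> S -> A -> R.

Definition step (hist : seq (Draw S A)) (d : Draw S A) (c : cfg R S A)
  : cfg R S A :=
  let Q1 := cQ1 c in let Q2 := cQ2 c in
  match cph c with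
  | Begin => Cfg Q1 Q2 (Act [::] (start hist d) (tabrule hist d))
  | Act tr s b =>
      let a := if d_explore d then d_action d
               else gsel (if b then Q1 s else Q2 s) in
      let tr' := rcons tr (s, a) in
      match f s a with
      | Some s' => Cfg Q1 Q2 (Act tr' s' b)
      | None => Cfg Q1 Q2 (Upd tr' 0)
      end
  | Upd tr t =>
      let nph := if (t.+1 < size tr)%N then Upd tr t.+1 else Begin in
      match drop t tr with
      | (s, a) :: _ =>
          let al := alpha hist s a in
          if d_coin d then
            Cfg (upd_at Q1 s a (Q1 s a + al * (gem_target Q1 Q2 (drop t tr) - Q1 s a)))
                Q2 nph
          else
            Cfg Q1
                (upd_at Q2 s a (Q2 s a + al * (gem_target Q2 Q1 (drop t tr) - Q2 s a)))
                nph
      | [::] => Cfg Q1 Q2 nph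
      end
  end.

Variables (Q1init Q2init : S -> A -> R).

Fixpoint run (ds : nat -> Draw S A) (n : nat) : cfg R S A :=
  match n with
  | 0 => Cfg Q1init Q2init Begin
  | n'.+1 => step (mkseq ds n') (ds n') (run ds n')
  end.

Definition eff_alpha (ds : nat -> Draw S A) (n : nat) (s : S) (a : A) : R :=
  match cph (run ds n) with
  | Upd tr t =>
      match drop t tr with
      | (s0, a0') :: _ => if (s0 == s) && (a0' == a) then alpha (mkseq ds n) s a else 0
      | [::] => 0
      end
  | _ => 0
  end.

End GEM.

Definition is_argmax_sel (R : realType) (hsel : seq R -> nat) : Prop :=
  forall l : seq R, l != [::] ->
    (hsel l < size l)%N /\ forall k, (k < size l)%N -> nth 0 l k <= nth 0 l (hsel l).

Definition is_greedy_sel (R : realType) (A : finType) (gsel : (A -> R) -> A) : Prop :=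
  forall (F : A -> R) (a : A), F a <= F (gsel F).

(* Main.v *)
Require Import Defs.
From HB Require Import structures.
From mathcomp Require Import all_boot all_order all_algebra.
From mathcomp Require Import all_classical all_reals all_analysis.
From mathcomp Require Import ring lra.
Import Order.TTheory GRing.Theory Num.Theory.
Import numFieldNormedType.Exports.
Local Open Scope classical_set_scope.
Local Open Scope ring_scope.

(* Let [G1 = V2_{h1}] and [G2 = V1_{h2}] be the two targets at an update of
   [(s, a)]. Since [h2] maximises [V2] and [h1] maximises [V1],
   [V2_{h1} - V1_{h1} <= G1 - G2 <= V2_{h2} - V1_{h2}], so [|G1 - G2|] is at most
   [gamma * |Q1 - Q2|]. Averaging over the fair coin, [Q1 - Q2] follows a
   contraction with rate [alpha / 2], perturbed by a martingale whose increments
   are [alpha] times a bounded factor; as the squares of the rates are summable,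
   this martingale converges, and [Q1 - Q2] tends to [0].
   Because transitions are deterministic, every [V_{t,h}] computed with [Qstar]
   is at most [Qstar s a], which gives [G <= Qstar s a + gamma * sup (Q - Qstar)^+];
   and [V1_{h1} >= V1_1] together with [Q1 - Q2 -> 0] gives the matching lower
   bound. Both one-sided errors therefore contract to [0], the rates of each
   single table having infinite sum by the same martingale convergence. *)

Lemma mkseq_eqP (X : Type) (n : nat) (u v : nat -> X) :
  mkseq u n = mkseq v n <-> (forall m, (m < n)%N -> u m = v m).
Proof.
split; last first.
  by move=> uv; apply/eq_in_map => m; rewrite mem_iota => /uv.
elim: n => [//|n IHn]; rewrite !mkseqS => /rcons_inj[/IHn uv uvn] m.
by rewrite ltnS leq_eqVlt => /orP[/eqP->//|/uv].
Qed.

(** * Almost sure convergence of martingale transforms of independent draws *)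

Section MartingaleTransform.
Context (R : realType) (X : finType) (p xi : X -> R).
Context (d : measure_display) (T : measurableType d) (P : probability T R).
Context (D : nat -> T -> X).
Hypothesis p_ge0 : forall x, 0 <= p x.
Hypothesis p_sum1 : \sum_x p x = 1.
Hypothesis xi_mean : \sum_x p x * xi x = 0.
Hypothesis xi_var : \sum_x p x * xi x ^+ 2 <= 1.
Hypothesis measurable_D : forall m x, measurable [set w | D m w = x].
Hypothesis law_D : forall n (x : nat -> X),
  P [set w | forall m, (m < n)%N -> D m w = x m] = (\prod_(m < n) p (x m))%:E.

Let hist (n : nat) (w : T) : seq X := mkseq (D^~ w) n.
Let W (h : seq X) : R := \prod_(x <- h) p x.
Let cyl (h : seq X) : set T := [set w | hist (size h) w = h].

Lemma measurable_hist n (Phi : seq X -> Prop) :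
  measurable [set w | Phi (hist n w)].
Proof.
elim: n Phi => [|n IHn] Phi.
  have [Phi0|nPhi0] := pselect (Phi [::]).
    rewrite [X in measurable X](_ : _ = setT)//.
    by apply/seteqP; split => w.
  rewrite [X in measurable X](_ : _ = set0)//.
  by apply/seteqP; split => w.
rewrite [X in measurable X](_ : _ = \bigcup_(x in [set: X])
  ([set w | D n w = x] `&` [set w | Phi (rcons (hist n w) x)])).
  apply: fin_bigcup_measurable; first exact: finite_finset.
  by move=> x _; apply: measurableI => //; exact: (IHn (fun h => Phi (rcons h x))).
rewrite /hist; apply/seteqP; split => w /=.
  by rewrite mkseqS => Phiw; exists (D n w).
by rewrite mkseqS => -[x _ [<-]].
Qed.

(** [X] is finite, so the first [n] draws take finitely many values and any predicate of them cuts
    out a measurable event. *)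
Lemma measurable_adapted n (Phi : (nat -> X) -> Prop) :
  (forall u v, (forall m, (m < n)%N -> u m = v m) -> Phi u -> Phi v) ->
  measurable [set w | Phi (D^~ w)].
Proof.
move=> Phi_ext.
rewrite [X in measurable X](_ : _ =
  [set w | exists2 u, mkseq u n = hist n w & Phi u]).
  exact: (measurable_hist n (fun h => exists2 u, mkseq u n = h & Phi u)).
apply/seteqP; split => w /=; first by exists (D^~ w).
by move=> [u /mkseq_eqP/Phi_ext]; exact.
Qed.

Lemma measurable_cyl h : measurable (cyl h).
Proof. exact: (measurable_hist _ (fun h' => h' = h)). Qed.

Lemma W_ge0 h : 0 <= W h.
Proof. exact: prodr_ge0. Qed.

Lemma W_rcons h x : W (rcons h x) = W h * p x.
Proof. by rewrite /W -cats1 big_cat /= big_seq1. Qed.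

Lemma P_cyl h : P (cyl h) = (W h)%:E.
Proof.
case: h => [|x0 h'].
  rewrite /W big_nil -(@probability_setT _ _ _ P); congr (P _).
  by apply/seteqP; split.
set h := x0 :: h'.
have := law_D (size h) (nth x0 h); rewrite /W (big_nth x0) big_mkord => <-.
congr (P _); apply/seteqP; split => w; rewrite /cyl /hist /=.
  by move=> <- m mh; rewrite nth_mkseq.
by move=> /mkseq_eqP ->; rewrite mkseq_nth.
Qed.

(** Conditioning on the next draw, expressed by subadditivity over the finitely many one-step
    extensions of [h]; [F x] bounds the conditional probability of [E] once [x] is drawn. *)
Lemma measure_cyl_split h (E : set T) (F : X -> R) : measurable E ->
  (forall x, P (E `&` cyl (rcons h x)) <= (W h * (p x * F x))%:E)%E ->
  (P (E `&` cyl h) <= (W h * \sum_x p x * F x)%:E)%E.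
Proof.
move=> mE EF.
have mEC h' : measurable (E `&` cyl h').
  by apply: measurableI => //; exact: measurable_cyl.
apply: (@le_trans _ _ (\sum_(x \in [set: X]) P (E `&` cyl (rcons h x)))%E).
  apply: content_sub_fsum => //; first exact: finite_finset.
  move=> w [Ew hw]; exists (D (size h) w) => //; split => //.
  by rewrite /cyl /hist /= size_rcons mkseqS (hw : mkseq _ _ = h).
rewrite mulr_sumr -sumEFin.
have -> : [set: X] = [set` index_enum X].
  by apply/seteqP; split => x //= _; rewrite mem_index_enum.
rewrite -fsbig_seq ?index_enum_uniq//; exact: lee_sum.
Qed.

Variable b : seq X -> R.
(** The coefficient sees only the draws strictly before [u n], so with [xi] centred these partial
    sums form a martingale. *)
Let S (u : nat -> X) := series (fun n => b (mkseq u n) * xi (u n)).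

Lemma transform_ext n u v :
  (forall m, (m < n)%N -> u m = v m) -> S u n = S v n.
Proof.
move=> uv; rewrite /S /series /= !big_mkord; apply: eq_bigr => i _.
congr (b _ * xi _); last exact: uv.
by apply/mkseq_eqP => m mi; apply: uv; apply: ltn_trans mi _.
Qed.

(** The offset [c] stands for an increment accumulated before time [m]; it lets an induction on [k]
    advance the starting time by one draw. *)
Let exc (e : R) m k c : set T := [set w | exists2 j, (j <= k)%N &
  e <= `|S (D^~ w) (m + j)%N - S (D^~ w) m + c|].

Lemma measurable_exc e m k c : measurable (exc e m k c).
Proof.
apply: (measurable_adapted (m + k)%N (fun u => exists2 j, (j <= k)%N &
  e <= `|S u (m + j)%N - S u m + c|)) => u v uv [j jk].
rewrite (transform_ext (m + j)%N u v); last first.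
  by move=> i ij; apply: uv; rewrite (leq_trans ij)// leq_add2l.
rewrite (transform_ext m u v); last first.
  by move=> i ij; apply: uv; rewrite (leq_trans ij)// leq_addr.
by exists j.
Qed.

(* Expected value, given the history [h], of the sum of the next [k] squares. *)
Fixpoint sqmass (k : nat) (h : seq X) : R :=
  if k is k'.+1 then b h ^+ 2 + \sum_x p x * sqmass k' (rcons h x) else 0.

Lemma sqmass_ge0 k h : 0 <= sqmass k h.
Proof.
elim: k h => [//|k IHk] h /=; rewrite addr_ge0 ?sqr_ge0//.
by apply: sumr_ge0 => x _; rewrite mulr_ge0.
Qed.

Lemma le_sqmassS k h : sqmass k h <= sqmass k.+1 h.
Proof.
elim: k h => [|k IHk] h; first exact: (sqmass_ge0 1).
rewrite /= lerD2l; apply: ler_sum => x _; exact: ler_wpM2l.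
Qed.

(** Kolmogorov's maximal inequality, conditional on [h]. Peeling off the next draw turns the offset
    [c] into [c + b h * xi x], whose mean square is at most [c ^+ 2 + b h ^+ 2], as [xi] has mean
    zero and second moment at most one. *)
Lemma maximal_inequality e k h c : 0 < e ->
  (P (exc e (size h) k c `&` cyl h)
     <= (W h * ((c ^+ 2 + sqmass k h) / e ^+ 2))%:E)%E.
Proof.
move=> e0.
(* An offset already as large as [e] makes the right-hand side at least [W h'], the probability of
   the whole cylinder. *)
have large k' h' c' : e <= `|c'| -> (P (exc e (size h') k' c' `&` cyl h')
     <= (W h' * ((c' ^+ 2 + sqmass k' h') / e ^+ 2))%:E)%E.
  move=> ec; apply: (@le_trans _ _ (P (cyl h'))).
    apply: le_measure; rewrite ?inE//; last exact: measurable_cyl.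
    by apply: measurableI; [exact: measurable_exc|exact: measurable_cyl].
  rewrite P_cyl lee_fin ler_peMr ?W_ge0// ler_pdivlMr ?exprn_gt0// mul1r.
  apply: (@le_trans _ _ (c' ^+ 2)); last by rewrite lerDl sqmass_ge0.
  by rewrite -(real_normK (num_real c')) lerXn2r ?nnegrE// ltW.
elim: k h c => [|k IHk] h c; have [/large//|ce] := leP e `|c|.
- rewrite [X in P X](_ : _ = set0).
    by rewrite measure0 lee_fin mulr_ge0 ?W_ge0// divr_ge0 ?addr_ge0 ?sqr_ge0.
  apply/seteqP; split => // w [[j]]; rewrite leqn0 => /eqP ->.
  by rewrite addn0 subrr add0r leNgt ce.
- pose F x := ((c + b h * xi x) ^+ 2 + sqmass k (rcons h x)) / e ^+ 2.
  apply: (@le_trans _ _ (W h * \sum_x p x * F x)%:E).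
    apply: measure_cyl_split; first exact: measurable_exc.
    move=> x; rewrite mulrA -W_rcons; apply: le_trans (IHk _ _).
    apply: le_measure; rewrite ?inE;
      [apply: measurableI; [exact: measurable_exc|exact: measurable_cyl]..|].
    move=> w [[j jk ej] hw]; split => //.
    (* A crossing at [j = 0] would be one of the offset itself, which is below [e] in absolute
       value; the crossing index can thus be shifted by one. *)
    case: j jk ej => [|j] jk ej.
      by move: ej; rewrite addn0 subrr add0r leNgt ce.
    exists j => //; rewrite size_rcons.
    have [wh wx] : mkseq (D^~ w) (size h) = h /\ D (size h) w = x.
      by move: hw; rewrite /cyl /hist /= size_rcons mkseqS => /rcons_inj[].
    suff <- : S (D^~ w) (size h + j.+1)%N - S (D^~ w) (size h) + c =
      S (D^~ w) ((size h).+1 + j)%N - S (D^~ w) (size h).+1 +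
        (c + b h * xi x) by [].
    rewrite addSnnS [S _ (size h).+1]/S /series /= big_nat_recr//= wh wx.
    by rewrite /S /series /=; ring.
  rewrite lee_fin ler_wpM2l ?W_ge0//.
  rewrite /F (eq_bigr (fun x => (p x * c ^+ 2 + (2 * c * b h) * (p x * xi x) +
     b h ^+ 2 * (p x * xi x ^+ 2) + p x * sqmass k (rcons h x)) / e ^+ 2));
     last by move=> x _; ring.
  rewrite -mulr_suml ler_wpM2r ?invr_ge0 ?exprn_ge0 ?(ltW e0)//.
  rewrite !big_split /= -!mulr_sumr -mulr_suml p_sum1 xi_mean.
  rewrite mul1r mulr0 addr0 -addrA lerD2l lerD2r.
  by rewrite ler_piMr ?sqr_ge0.
Qed.

(** Averages the maximal inequality over the [i] draws that follow [h]; the difference of masses is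
    the expected sum of squares over the window of length [k] alone. *)
Lemma maximal_inequality_from e i k h : 0 < e ->
  (P (exc e (size h + i) k 0 `&` cyl h)
     <= (W h * ((sqmass (i + k) h - sqmass i h) / e ^+ 2))%:E)%E.
Proof.
move=> e0; elim: i h => [|i IHi] h.
  by have := maximal_inequality e k h 0 e0; rewrite expr0n add0r subr0 addn0.
apply: (@le_trans _ _ (W h * \sum_x p x *
    ((sqmass (i + k) (rcons h x) - sqmass i (rcons h x)) / e ^+ 2))%:E).
  apply: measure_cyl_split; first exact: measurable_exc.
  by move=> x; rewrite mulrA -W_rcons addnS -addSn -(size_rcons h x).
rewrite lee_fin ler_wpM2l ?W_ge0// /=.
under eq_bigr do rewrite mulrA mulrBr.
by rewrite -mulr_suml sumrB ler_wpM2r ?invr_ge0 ?exprn_ge0 ?(ltW e0)//; lra.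
Qed.

Let sqsum (h : seq X) : R := \sum_(i < size h) b (take i h) ^+ 2.

Lemma sqsum_rcons h x : sqsum (rcons h x) = sqsum h + b h ^+ 2.
Proof.
rewrite /sqsum size_rcons big_ord_recr /=; congr (_ + b _ ^+ 2).
  by apply: eq_bigr => i _; rewrite -cats1 takel_cat// ltnW.
by rewrite -cats1 takel_cat// take_size.
Qed.

Variable K : R.
Hypothesis sqsum_le : forall h, sqsum h <= K.

(** The squares along any path have budget [K], of which [sqsum h] is already spent; the conditional
    expectation of the later ones cannot exceed the rest. *)
Lemma sqmass_le k h : sqmass k h <= K - sqsum h.
Proof.
elim: k h => [|k IHk] h /=; first by rewrite subr_ge0.
have : \sum_x p x * sqmass k (rcons h x) <=
       \sum_x p x * (K - sqsum h - b h ^+ 2).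
  apply: ler_sum => x _; apply: ler_wpM2l => //.
  by rewrite -addrA -opprD -(sqsum_rcons h x).
by rewrite -mulr_suml p_sum1; lra.
Qed.

(** The event lies in every [B i], whose probability is at most the tail of the expected sum of
    squares divided by [e ^+ 2]; that sum is bounded by [K], so its tail vanishes. *)
Lemma oscillation_null e : 0 < e ->
  P.-negligible [set w | forall i, exists k,
    e <= `|S (D^~ w) (i + k)%N - S (D^~ w) i|].
Proof.
move=> e0.
pose v n := sqmass n [::].
have v_nd : {homo v : n m / (n <= m)%N >-> n <= m}.
  by apply: homo_leq => //; [move=> x y z; exact: le_trans
                            |move=> n; exact: le_sqmassS].
have v_cvg : cvgn v.
  apply: nondecreasing_is_cvgn => //; exists K => _ [n _ <-].
  by rewrite (le_trans (sqmass_le _ _))// /sqsum big_ord0 subr0.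
pose B i := \bigcup_k exc e i k 0.
have mB i : measurable (B i).
  by apply: bigcupT_measurable => k; exact: measurable_exc.
(* The window length [k] goes to infinity by continuity from below. *)
have PB i : (P (B i) <= ((limn v - v i) / e ^+ 2)%:E)%E.
  have nd : {homo exc e i ^~ 0 : n m / (n <= m)%N >-> (n <= m)%O}.
    move=> n m nm; apply/subsetPset => w [j jn ej]; exists j => //.
    exact: leq_trans nm.
  have cv : (P \o exc e i ^~ 0) k @[k --> \oo] --> P (B i).
    apply: nondecreasing_cvg_mu; [|exact: mB|exact: nd].
    by move=> k; exact: measurable_exc.
  rewrite -(cvg_lim _ cv)//; apply: lime_le; first by apply/cvg_ex; eexists; exact: cv.
  apply: nearW => k /=.
  have := maximal_inequality_from e i k [::] e0.
  rewrite /W big_nil mul1r add0n (_ : cyl [::] = setT) ?setIT; last first.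
    by apply/seteqP; split.
  move=> /le_trans; apply; rewrite lee_fin ler_wpM2r ?invr_ge0 ?exprn_ge0 ?(ltW e0)//.
  by rewrite lerD2r; exact: nondecreasing_cvgn_le.
exists (\bigcap_i B i); split.
- exact: bigcapT_measurable.
- apply/eqP; rewrite eq_le measure_ge0 andbT; apply/lee_addgt0Pr => q q0.
  rewrite add0e.
  have qe : 0 < q * e ^+ 2 by rewrite mulr_gt0 ?exprn_gt0.
  have /cvgrPdist_le/(_ _ qe)[i _ /(_ i (leqnn i)) vi] := v_cvg.
  apply: (@le_trans _ _ (P (B i))).
    apply: le_measure; rewrite ?inE//; last exact: bigcap_inf.
    exact: bigcapT_measurable.
  apply: le_trans (PB i) _; rewrite lee_fin ler_pdivrMr ?exprn_gt0//.
  exact: le_trans (ler_norm _) vi.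
- move=> w wS i _; have [k ek] := wS i; exists k => //; exists k => //.
  by rewrite addr0.
Qed.

Lemma bounded_transform_cvg : {ae P, forall w, cvgn (S (D^~ w))}.
Proof.
have : {ae P, forall w, forall q : nat, ~ (forall i, exists k,
    q.+1%:R^-1 <= `|S (D^~ w) (i + k)%N - S (D^~ w) i|)}.
  apply: ae_foralln => q.
  apply: negligibleS (oscillation_null q.+1%:R^-1 _) => //.
  by move=> w /= /contrapT.
apply: filterS => w osc; apply/cauchy_cvgP; apply: cauchy_exP => e e0.
have [q qe] : exists q, q.+1%:R^-1 < e.
  by have [q] := ltr_add_invr e0; rewrite add0r; exists q.
have /existsNP[i /forallNP Si] := osc q.
exists (S (D^~ w) i), i => // n /= i_n; rewrite /ball /= distrC.
have /negP := Si (n - i)%N; rewrite subnKC// -ltNge => /lt_trans; exact.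
Qed.

End MartingaleTransform.

(** Localisation: the coefficient is switched off for good once its running sum of squares, current
    term included, exceeds [K]. The test reads [h] alone, so the truncated coefficient stays
    predictable. *)
Definition truncate (R : realType) (X : finType) (b : seq X -> R) (K : R)
    (h : seq X) : R :=
  if \sum_(i < size h) b (take i h) ^+ 2 + b h ^+ 2 <= K then b h else 0.

Lemma truncate_sqsum (R : realType) (X : finType) (b : seq X -> R) (K : R) h :
  0 <= K -> \sum_(i < size h) truncate R X b K (take i h) ^+ 2 <= K.
Proof.
move=> K0; pose V (c : seq X -> R) h := \sum_(i < size h) c (take i h) ^+ 2.
(* The second inequality feeds the induction: while the test succeeds, the truncated sum is below
   the full one, itself at most [K]. *)
suff /andP[] : (V (truncate R X b K) h <= K) && (V (truncate R X b K) h <= V b h).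
  by [].
elim/last_ind: h => [|h x /andP[IH1 IH2]]; first by rewrite /V !big_ord0 K0 lexx.
rewrite /V !sqsum_rcons -!/(V _ _) {2 4}/truncate -/(V b h).
have b0 := sqr_ge0 (b h).
by case: ifP => Kh; apply/andP; split; lra.
Qed.

Lemma sqsum_mkseq (R : realType) (X : finType) (b : seq X -> R) u n :
  \sum_(i < size (mkseq u n)) b (take i (mkseq u n)) ^+ 2 =
  series (fun m => b (mkseq u m) ^+ 2) n.
Proof.
elim: n => [|n IHn]; first by rewrite big_ord0 /series /= big_geq.
by rewrite mkseqS sqsum_rcons IHn /series /= big_nat_recr.
Qed.

(** Almost surely the truncations at all integer levels converge at once; on a path with finite
    square sum, a level above that sum never truncates. *)
Theorem transform_cvg (R : realType) (X : finType) (p xi : X -> R)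
    (d : measure_display) (T : measurableType d) (P : probability T R)
    (D : nat -> T -> X) (b : seq X -> R) :
  (forall x, 0 <= p x) -> \sum_x p x = 1 ->
  \sum_x p x * xi x = 0 -> \sum_x p x * xi x ^+ 2 <= 1 ->
  (forall m x, measurable [set w | D m w = x]) ->
  (forall n (x : nat -> X),
    P [set w | forall m, (m < n)%N -> D m w = x m] = (\prod_(m < n) p (x m))%:E) ->
  {ae P, forall w,
    cvgn (series (fun n => b (mkseq (D^~ w) n) ^+ 2)) ->
    cvgn (series (fun n => b (mkseq (D^~ w) n) * xi (D n w)))}.
Proof.
move=> p0 p1 xi0 xi1 mD law.
have : {ae P, forall w, forall K : nat, cvgn (series (fun n =>
    truncate R X b K%:R (mkseq (D^~ w) n) * xi (D n w)))}.
  apply: ae_foralln => K.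
  apply: (bounded_transform_cvg R X p xi d T P D _ _ _ _ _ _ _ K%:R) => // h.
  by apply: truncate_sqsum.
apply: filterS => w trunc_cvg b_cvg.
set l := limn (series (fun n => b (mkseq (D^~ w) n) ^+ 2)) in b_cvg.
have sq_le n : series (fun n => b (mkseq (D^~ w) n) ^+ 2) n <= l.
  apply: nondecreasing_cvgn_le => //; apply: nondecreasing_series => k _ _.
  exact: sqr_ge0.
have l0 : 0 <= l by apply: le_trans (sq_le 0%N); rewrite /series /= big_geq.
have := trunc_cvg (Num.bound l).
suff -> : (fun n => truncate R X b (Num.bound l)%:R (mkseq (D^~ w) n) * xi (D n w)) =
  (fun n => b (mkseq (D^~ w) n) * xi (D n w)) by [].
apply/funext => n; congr (_ * _); rewrite /truncate sqsum_mkseq ifT//.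
have := sq_le n.+1; rewrite {1}/series /= big_nat_recr//= => /le_trans; apply.
exact: ltW (archi_boundP l0).
Qed.

(** * Deterministic recursions whose rates have infinite sum *)

Lemma damped_near_le (R : realType) (a z : nat -> R) (N : nat) (e : R) :
  0 < e -> (forall n, 0 <= a n <= 1) -> series a @ \oo --> +oo ->
  (forall n, (N <= n)%N -> z n.+1 <= (1 - a n) * z n) ->
  \forall n \near \oo, z n <= e.
Proof.
move=> e0 a01 a_oo zS; pose C := Num.max (z N) 0.
have C0 : 0 <= C by rewrite le_max lexx orbT.
have s_ge0 k : 0 <= series a (N + k)%N - series a N.
  rewrite subr_ge0; apply: nondecreasing_series; last exact: leq_addr.
  by move=> n _ _; case/andP: (a01 n).
(* [(1 - a) (1 + s + a) <= 1 + s], whence the product of the factors [1 - a]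
   is at most the inverse of one plus the sum of the [a]. *)
have zC k : z (N + k)%N * (1 + (series a (N + k)%N - series a N)) <= C.
  elim: k => [|k IHk]; first by rewrite addn0 subrr addr0 mulr1 le_max lexx.
  have [zn|zp] := leP (z (N + k.+1)%N) 0.
    by apply: le_trans C0; rewrite mulr_le0_ge0// addr_ge0.
  have /andP[a0 a1] := a01 (N + k)%N.
  have := zS (N + k)%N (leq_addr _ _); rewrite -addnS => zz.
  have -> : series a (N + k.+1)%N = series a (N + k)%N + a (N + k)%N.
    by rewrite addnS /series /= big_nat_recr.
  apply: le_trans IHk; move: (s_ge0 k) => sk.
  have zk : 0 <= z (N + k)%N.
    rewrite leNgt; apply/negP => zk; move: zp; rewrite ltNge => /negP; apply.
    by apply: le_trans zz _; rewrite mulr_ge0_le0 ?subr_ge0// ltW.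
  set s := series a _ - _ in sk *.
  rewrite addrAC -/s.
  apply: (@le_trans _ _ ((1 - a (N + k)%N) * z (N + k)%N * (1 + (s + a (N + k)%N)))).
    by apply: ler_wpM2r => //; lra.
  rewrite mulrAC -subr_ge0.
  have -> : z (N + k)%N * (1 + s) - (1 - a (N + k)%N) * (1 + (s + a (N + k)%N)) * z (N + k)%N
     = z (N + k)%N * (a (N + k)%N * (s + a (N + k)%N)) by ring.
  by rewrite !mulr_ge0// addr_ge0.
(* With [s] the sum of the rates after [N], having [z n > e] would force [e * (1 + s) <= C], which
   is impossible once [s >= C / e]. *)
move/cvgryPge/(_ (C / e + series a N)) : a_oo => a_oo.
near=> n.
have Nn : (N <= n)%N by near: n; exists N.
have := zC (n - N)%N; rewrite subnKC// => zCn.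
have an : C / e + series a N <= series a n by near: n.
have sn : C / e <= series a n - series a N by lra.
have [zn|zp] := leP (z n) 0; first by rewrite (le_trans zn)// ltW.
rewrite leNgt; apply/negP => ez.
have Ce0 : 0 <= C / e by rewrite divr_ge0// ltW.
have : e * (1 + C / e) <= C.
  apply: le_trans zCn; apply: ler_pM => //; [exact: ltW|lra|exact: ltW|lra].
by rewrite mulrDr mulr1 mulrCA divff ?gt_eqF// mulr1; lra.
Unshelve. all: by end_near. Qed.

(** Bootstrapping: an eventual bound [B >= e] improves to [kappa * B], so finitely many rounds bring
    the initial bound down to [e]. *)
Lemma contraction_near_le (R : realType) (I : finType) (gamma B0 : R)
    (a x : nat -> I -> R) :
  0 <= gamma < 1 -> (forall n i, 0 <= a n i <= 1) ->
  (forall i, series (a^~ i) @ \oo --> +oo) ->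
  (\forall n \near \oo, forall i, x n i <= B0) ->
  (forall e, 0 < e -> \forall n \near \oo, forall i B, 0 <= B ->
     (forall j, x n j <= B) ->
     x n.+1 i <= (1 - a n i) * x n i + a n i * (gamma * B + e)) ->
  forall e, 0 < e -> \forall n \near \oo, forall i, x n i <= e.
Proof.
move=> /andP[g0 g1] a01 a_oo xB0 xS e e0.
(* [kappa] is [gamma] plus twice [(1 - gamma) / 4]: one quarter pays for the bias, the other for the
   residual distance to the attracting level [u]. *)
pose kappa := (1 + gamma) / 2.
have kappa0 : 0 <= kappa by rewrite /kappa; lra.
have kappa1 : kappa < 1 by rewrite /kappa; lra.
pose B1 := Num.max B0 0.
have B10 : 0 <= B1 by rewrite le_max lexx orbT.
have step k : \forall n \near \oo, forall i, x n i <= Num.max e (kappa ^+ k * B1).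
  elim: k => [|k IHk].
    by apply: filterS xB0 => n xB0 i; rewrite mul1r !le_max xB0 orbT.
  set B := Num.max e (kappa ^+ k * B1) in IHk.
  have eB : e <= B by rewrite le_max lexx.
  have Bp : 0 < B := lt_le_trans e0 eB.
  have dp : 0 < (1 - gamma) / 4 * e by rewrite mulr_gt0//; lra.
  have [N _ HN] : \forall n \near \oo, (forall i, x n i <= B) /\
      forall i B, 0 <= B -> (forall j, x n j <= B) ->
      x n.+1 i <= (1 - a n i) * x n i + a n i * (gamma * B + (1 - gamma) / 4 * e).
    by near=> n; split; near: n; [exact: IHk|exact: xS].
  pose u := gamma * B + (1 - gamma) / 4 * B.
  have dB : 0 < (1 - gamma) / 4 * B by rewrite mulr_gt0//; lra.
  have xu i : \forall n \near \oo, x n i - u <= (1 - gamma) / 4 * B.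
    apply: (@damped_near_le R (a^~ i) (fun n => x n i - u) N) => // n Nn.
    have [xB /(_ i B (ltW Bp) xB) xn] := HN n Nn.
    have /andP[ai0 ai1] := a01 n i.
    have : (1 - gamma) / 4 * e <= (1 - gamma) / 4 * B by rewrite ler_wpM2l//; lra.
    move=> /(lerD (lexx (gamma * B)))/(ler_wpM2l ai0) au.
    by rewrite -/u in au *; lra.
  have : \forall n \near \oo, forall i, x n i - u <= (1 - gamma) / 4 * B.
    by apply: filter_forall.
  apply: filterS => n xn i; apply: (@le_trans _ _ (kappa * B)).
    by have := xn i; rewrite /u /kappa; lra.
  rewrite /B maxr_pMr// exprS mulrA ge_max !le_max lexx orbT andbT.
  by apply/orP; left; rewrite ler_piMl// ltW.
have [k ke] : exists k, kappa ^+ k * B1 <= e.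
  have /cvgrPdist_le/(_ (e / (B1 + 1))) : geometric 1 kappa @ \oo --> (0 : R).
    by apply: cvg_geometric; rewrite ger0_norm.
  case; first by rewrite divr_gt0//; lra.
  move=> k _ /(_ k (leqnn k)); rewrite sub0r normrN /= mul1r.
  rewrite ger0_norm ?exprn_ge0// ler_pdivlMr; last by lra.
  move=> ke; exists k; apply: le_trans ke; rewrite ler_wpM2l ?exprn_ge0//; lra.
by apply: filterS (step k) => n xn i; have := xn i; rewrite max_l.
Unshelve. all: by end_near. Qed.

(** * Two coupled tables driven by a coin, on a fixed sample path *)

Section DoubleIteration.
Context (R : realType) (I : finType) (gamma C : R).
Context (al : nat -> I -> R) (c : nat -> bool).
Context (Q : bool -> nat -> I -> R) (G : bool -> nat -> R) (Qs : I -> R).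
Let xi n : R := if c n then 2^-1 else - 2^-1.

Hypothesis gamma01 : 0 <= gamma < 1.
Hypothesis al01 : forall n i, 0 <= al n i <= 1.
Hypothesis QS : forall t n i,
  Q t n.+1 i = Q t n i + (if c n == t then al n i else 0) * (G t n - Q t n i).
Hypothesis Q_bounded : forall t n i, `|Q t n i| <= C.
(** A target at step [n] is aimed at the entry [i] whose rate is nonzero, so its bounds are stated
    for such entries. *)
Hypothesis G_diff : forall n i E, al n i != 0 ->
  (forall j, `|Q true n j - Q false n j| <= E) ->
  `|G true n - G false n| <= gamma * E.
Hypothesis G_upper : forall t n i B, al n i != 0 -> 0 <= B ->
  (forall j, Q (~~ t) n j <= Qs j + B) -> G t n <= Qs i + gamma * B.
Hypothesis G_lower : forall t n i B E, al n i != 0 -> 0 <= B ->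
  (forall j, Qs j - B <= Q t n j) ->
  (forall j, `|Q true n j - Q false n j| <= E) ->
  Qs i - gamma * B - gamma * E <= G t n.
Hypothesis al_series : forall i, series (al^~ i) @ \oo --> +oo.
Hypothesis coin_series : forall i, cvgn (series (fun n => al n i * xi n)).
Hypothesis noise_series : forall i, cvgn (series (fun n =>
  al n i * (G true n + G false n - Q true n i - Q false n i) * xi n)).

(** The rate of one table is half of [al] plus or minus [al * xi]: the first part has infinite sum
    and the second a convergent one. *)
Lemma table_rate_series t i :
  series (fun n => if c n == t then al n i else 0) @ \oo --> +oo.
Proof.
apply/cvgryPge => M.
have /cvgrPdist_le/(_ 1 ltr01) := coin_series i.
set l := limn _ => coin_l.
have /cvgryPge/(_ (2 * (M + `|l| + 1))) := al_series i.
move=> al_M; near=> n.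
have : `|l - series (fun n => al n i * xi n) n| <= 1 by near: n.
have : 2 * (M + `|l| + 1) <= series (al^~ i) n by near: n.
have -> : series (fun n => if c n == t then al n i else 0) n =
  2^-1 * series (al^~ i) n +
  (if t then 1 else -1) * series (fun n => al n i * xi n) n.
  rewrite /series /= !mulr_sumr -big_split; apply: eq_bigr => k _ /=.
  by rewrite /xi; case: (c k) t => -[] /=; field.
have := ler_norm l; have := ler_norm (- l); rewrite normrN.
rewrite ler_norml => l1 l2 Mn /andP[ln1 ln2].
by case: t; lra.
Unshelve. all: by end_near. Qed.

Lemma table_rate01 t n i : 0 <= (if c n == t then al n i else 0) <= 1.
Proof. by case: ifP => // _; rewrite lexx ler01. Qed.

(* The coin noise is absorbed into the tail [N n i] of a convergent series, so
   that [Q true - Q false - N] satisfies a noiseless recursion with rate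
   [al / 2] and vanishing bias. *)
Lemma tables_merge e : 0 < e ->
  \forall n \near \oo, forall i, `|Q true n i - Q false n i| <= e.
Proof.
move=> e0.
pose M i := series (fun n =>
  al n i * (G true n + G false n - Q true n i - Q false n i) * xi n).
pose N n i := M i n - limn (M i).
have N_small q : 0 < q -> \forall n \near \oo, forall i, `|N n i| <= q.
  move=> q0; apply: filter_forall => i.
  have /cvgrPdist_le/(_ q q0) := noise_series i.
  by apply: filterS => n; rewrite distrC.
pose y n i := Q true n i - Q false n i - N n i.
(* Both signs are kept as separate indices, so that the one-sided contraction lemma bounds the
   absolute value. *)
pose sg (b : bool) : R := if b then 1 else -1.
pose x n (k : I * bool) := sg k.2 * y n k.1.
have x_small q : 0 < q -> \forall n \near \oo, forall k, x n k <= q.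
  apply: (contraction_near_le R (I * bool)%type gamma (2 * C + 1)
    (fun n k => al n k.1 / 2)) => //.
  - by move=> n k; have := al01 n k.1; lra.
  - move=> [i s] /=; apply/cvgryPge => L.
    have /cvgryPge/(_ (2 * L)) := al_series i; apply: filterS => n.
    by rewrite /series /= -mulr_suml; lra.
  - apply: filterS (N_small 1 ltr01) => n N1 [i s].
    have := N1 i; have := Q_bounded true n i; have := Q_bounded false n i.
    rewrite !ler_norml /x /y /sg /=.
    by case: s => /= /andP[? ?] /andP[? ?] /andP[? ?]; lra.
  - move=> d d0; have d20 : 0 < d / 2 by lra.
    apply: filterS (N_small _ d20) => n Nd [i s] B B0 xB /=.
    have DE j : `|Q true n j - Q false n j| <= B + d / 2.
      have := Nd j; have := xB (j, true); have := xB (j, false).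
      rewrite /x /y /sg /= !ler_norml => ? ? /andP[? ?].
      by apply/andP; split; lra.
    (* For either face of the coin, the increment of the gap is its mean over the coin plus the
       current term of [M]; subtracting [N] leaves the mean. *)
    have yS : y n.+1 i = (1 - al n i / 2) * y n i +
        al n i / 2 * (G true n - G false n - N n i).
      rewrite /y /N /M /series /= big_nat_recr //= !QS /xi.
      by case: (c n) => /=; field.
    rewrite /x /= yS mulrDr mulrCA lerD2l mulrCA.
    have [->|al_neq0] := eqVneq (al n i) 0; first by rewrite !mul0r.
    have /andP[al0 _] := al01 n i.
    apply: ler_wpM2l; first by lra.
    have := G_diff n i _ al_neq0 DE; have := Nd i; move: (gamma01).
    rewrite !ler_norml => /andP[g0 g1] /andP[? ?] /andP[? ?].
    have : gamma * (d / 2) <= d / 2 by rewrite ler_piMl; lra.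
    by rewrite /sg; case: s; lra.
have e20 : 0 < e / 2 by lra.
near=> n => i.
have Nn : forall i, `|N n i| <= e / 2 by near: n; exact: N_small.
have xn : forall k, x n k <= e / 2 by near: n; exact: x_small.
have := xn (i, true); have := xn (i, false); have := Nn i.
rewrite !ler_norml /x /y /sg /= => /andP[? ?] ? ?.
by apply/andP; split; lra.
Unshelve. all: by end_near. Qed.

(** The target of one table is evaluated with the other, so the excesses of both tables are
    contracted as one family on [I * bool]. *)
Lemma tables_upper e : 0 < e ->
  \forall n \near \oo, forall k : I * bool, Q k.2 n k.1 - Qs k.1 <= e.
Proof.
have [B0 QB0] : exists B0, forall i, - Qs i <= B0.
  by exists (\big[Order.max/0]_i - Qs i) => i; exact: le_bigmax.
apply: (contraction_near_le R (I * bool)%type gamma (C + B0)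
    (fun n k => if c n == k.2 then al n k.1 else 0)) => //.
- by move=> n k; exact: table_rate01.
- by move=> [i t]; exact: table_rate_series.
- apply: nearW => n [i t] /=; have := Q_bounded t n i; have := QB0 i.
  by rewrite ler_norml => ? /andP[? ?]; lra.
- move=> d d0; apply: nearW => n [i t] B B0' xB /=; rewrite QS.
  set a := (if _ then _ else _).
  have /andP[a0 _] : 0 <= a <= 1 := table_rate01 t n i.
  have [->|a_neq0] := eqVneq a 0; first by rewrite !mul0r; lra.
  have al_neq0 : al n i != 0.
    by apply: contra_neq a_neq0; rewrite /a => ->; case: ifP.
  have GB : G t n <= Qs i + gamma * B.
    by apply: G_upper => // j; have := xB (j, ~~ t) => /=; lra.
  have := ler_wpM2l a0 GB; have : 0 <= a * d by rewrite mulr_ge0// ltW.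
  by lra.
Qed.

(** Here a table contracts against its own deficit, up to a bias from the gap between the tables,
    which [tables_merge] makes arbitrarily small. *)
Lemma tables_lower e : 0 < e ->
  \forall n \near \oo, forall k : I * bool, Qs k.1 - Q k.2 n k.1 <= e.
Proof.
have [B0 QB0] : exists B0, forall i, Qs i <= B0.
  by exists (\big[Order.max/0]_i Qs i) => i; exact: le_bigmax.
apply: (contraction_near_le R (I * bool)%type gamma (C + B0)
    (fun n k => if c n == k.2 then al n k.1 else 0)) => //.
- by move=> n k; exact: table_rate01.
- by move=> [i t]; exact: table_rate_series.
- apply: nearW => n [i t] /=; have := Q_bounded t n i; have := QB0 i.
  by rewrite ler_norml => ? /andP[? ?]; lra.
- move=> d d0; apply: filterS (tables_merge d d0) => n DE [i t] B B0' xB /=.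
  rewrite QS; set a := (if _ then _ else _).
  have /andP[a0 _] : 0 <= a <= 1 := table_rate01 t n i.
  have [->|a_neq0] := eqVneq a 0; first by rewrite !mul0r; lra.
  have al_neq0 : al n i != 0.
    by apply: contra_neq a_neq0; rewrite /a => ->; case: ifP.
  have GB : Qs i - gamma * B - gamma * d <= G t n.
    by apply: G_lower => // j; have := xB (j, t) => /=; lra.
  have GBd : Qs i - gamma * B - d <= G t n.
    apply: le_trans GB; rewrite lerD2l lerN2; case/andP: (gamma01) => _ g1.
    by rewrite ler_piMl// ltW.
  have := ler_wpM2l a0 GBd; by lra.
Qed.

Theorem double_iteration_cvg t i : Q t n i @[n --> \oo] --> Qs i.
Proof.
apply/cvgrPdist_le => e e0.
near=> n.
have lo : forall k : I * bool, Qs k.1 - Q k.2 n k.1 <= e.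
  by near: n; exact: tables_lower.
have up : forall k : I * bool, Q k.2 n k.1 - Qs k.1 <= e.
  by near: n; exact: tables_upper.
by rewrite ler_norml; have := lo (i, t); have := up (i, t) => /=; lra.
Unshelve. all: by end_near. Qed.

End DoubleIteration.

(** * Maximum over actions *)

Section MaxOverA.
Context (R : realType) (A : finType) (a0 : A).

Lemma le_maxOverA (F : A -> R) a : F a <= maxOverA a0 F.
Proof. exact: le_bigmax. Qed.

Lemma maxOverA_le (F : A -> R) B : (forall a, F a <= B) -> maxOverA a0 F <= B.
Proof. by move=> FB; apply: bigmax_le => // a _; exact: FB. Qed.

Lemma maxOverA_leD (F F' : A -> R) B :
  (forall a, F a <= F' a + B) -> maxOverA a0 F <= maxOverA a0 F' + B.
Proof.
move=> FF'; apply: maxOverA_le => a; apply: le_trans (FF' a) _.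
by rewrite lerD2r le_maxOverA.
Qed.

Lemma maxOverA_norm_le (F : A -> R) B :
  (forall a, `|F a| <= B) -> `|maxOverA a0 F| <= B.
Proof.
move=> FB; rewrite ler_norml maxOverA_le ?andbT; last first.
  by move=> a; apply: le_trans (FB a); exact: ler_norm.
apply: le_trans (le_maxOverA F a0); have := FB a0.
by rewrite ler_norml => /andP[].
Qed.

End MaxOverA.

(** * Bounds on the targets along a deterministic trajectory *)

Section Targets.
Context (R : realType) (S A : finType) (a0 : A).
Context (f : S -> A -> option S) (r : S -> A -> R) (gamma : R).
Context (hsel : seq R -> nat) (Qstar : S -> A -> R).
Hypothesis gamma01 : 0 <= gamma < 1.
Hypothesis hsel_argmax : is_argmax_sel hsel.
Hypothesis bellman : forall s a, Qstar s a = r s a + gamma *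
  (match f s a with Some s' => maxOverA a0 (Qstar s') | None => 0 end).

Let V := Vgem a0 r gamma.

(** Determinism of the transitions enters here: as states follow [f] and the last pair terminates,
    the horizon [0] value of the tail is exactly the continuation term of the Bellman equation. *)
Fixpoint complete_path (tr : seq (S * A)) : Prop :=
  if tr is (s, a) :: rest then
    match f s a, rest with
    | Some s', (s'', _) :: _ => s'' = s'
    | None, [::] => True
    | _, _ => False
    end /\ complete_path rest
  else True.

Lemma bellman_path s a rest : complete_path ((s, a) :: rest) ->
  Qstar s a = r s a + gamma * V Qstar rest 0.
Proof.
rewrite /= bellman => -[+ _]; case: (f s a) => [s'|].
  by case: rest => // -[s'' a'] rest ->.
by case: rest.
Qed.

(** Following the realised actions for [h] steps and acting greedily afterwards cannot beat optimal
    play; an excess of [Q] over [Qstar] is only discounted on the way. *)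
Lemma Vgem_le Q B tr h : 0 <= B -> (forall s a, Q s a <= Qstar s a + B) ->
  complete_path tr -> V Q tr h <= V Qstar tr 0 + B.
Proof.
case/andP: gamma01 => g0 g1 B0 QB.
elim: h tr => [|h IHh] [|[s a] rest] path_tr; rewrite /V /= ?add0r//.
  exact: maxOverA_leD.
apply: le_trans (_ : Qstar s a + B <= _); last by rewrite lerD2r le_maxOverA.
rewrite (bellman_path _ _ _ path_tr) -addrA lerD2l.
apply: le_trans (_ : gamma * (V Qstar rest 0 + B) <= _).
  by apply: ler_wpM2l => //; apply: IHh; case: path_tr.
by rewrite mulrDr lerD2l ler_piMl// ltW.
Qed.

Lemma Vgem_dist Q Q' E tr h : (forall s a, `|Q s a - Q' s a| <= E) -> 0 <= E ->
  `|V Q tr h - V Q' tr h| <= E.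
Proof.
case/andP: gamma01 => g0 g1 QE E0.
elim: h tr => [|h IHh] [|[s a] rest]; rewrite /V /= ?subrr ?normr0//.
  have h1 : maxOverA a0 (Q s) <= maxOverA a0 (Q' s) + E.
    by apply: maxOverA_leD => a'; have := QE s a'; rewrite ler_norml; lra.
  have h2 : maxOverA a0 (Q' s) <= maxOverA a0 (Q s) + E.
    by apply: maxOverA_leD => a'; have := QE s a'; rewrite ler_norml; lra.
  by rewrite ler_norml; lra.
rewrite opprD addrACA subrr add0r -mulrBr normrM ger0_norm//.
apply: le_trans (_ : gamma * E <= _); first by rewrite ler_wpM2l.
by rewrite ler_piMl// ltW.
Qed.

(** A positive horizon starts with a reward common to both tables, which gains one factor [gamma]
    over [Vgem_dist]. *)
Lemma VgemS_dist Q Q' E tr h : (forall s a, `|Q s a - Q' s a| <= E) -> 0 <= E ->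
  `|V Q tr h.+1 - V Q' tr h.+1| <= gamma * E.
Proof.
case/andP: gamma01 => g0 g1 QE E0; case: tr => [|[s a] rest]; rewrite /V /=.
  by rewrite subrr normr0 mulr_ge0.
rewrite opprD addrACA subrr add0r -mulrBr normrM ger0_norm// ler_wpM2l//.
exact: Vgem_dist.
Qed.

(** The bound [C] reproduces itself because [(1 - gamma) * C + gamma * C = C]. *)
Lemma Vgem_norm_le Q C tr h : 0 <= C -> (forall s a, `|Q s a| <= C) ->
  (forall s a, `|r s a| <= (1 - gamma) * C) -> `|V Q tr h| <= C.
Proof.
case/andP: gamma01 => g0 g1 C0 QC rC.
elim: h tr => [|h IHh] [|[s a] rest]; rewrite /V /= ?normr0//.
  exact: maxOverA_norm_le.
apply: le_trans (ler_normD _ _) _; rewrite normrM (ger0_norm g0).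
by have := rC s a; have := ler_wpM2l g0 (IHh rest); rewrite /V; lra.
Qed.

Let target := gem_target a0 r gamma hsel.

Lemma le_Vgem_hstar Q tr k : (k < size tr)%N ->
  V Q tr k.+1 <= V Q tr (hstar a0 r gamma hsel Q tr).
Proof.
move=> ktr; set l := Vlist a0 r gamma Q tr.
have szl : size l = size tr by rewrite size_map size_iota.
(* Position [j] of the list holds horizon [j.+1], the same shift that [hstar] applies to the
   selected index. *)
have nthl j : (j < size tr)%N -> nth 0 l j = V Q tr j.+1.
  by move=> jtr; rewrite (nth_map 0%N) ?size_iota// nth_iota.
have l_neq0 : l != [::] by rewrite -size_eq0 szl -lt0n; case: (size tr) ktr.
have [hl /(_ k)] := hsel_argmax l l_neq0.
by rewrite szl in hl *; rewrite (nthl _ ktr) (nthl _ hl); exact.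
Qed.

Lemma target_dist Q Q' E s a rest : let tr := (s, a) :: rest in
  (forall s a, `|Q s a - Q' s a| <= E) ->
  `|target Q Q' tr - target Q' Q tr| <= gamma * E.
Proof.
move=> tr QE.
have E0 : 0 <= E := le_trans (normr_ge0 _) (QE s a).
have hsel_tr Q'' : (hsel (Vlist a0 r gamma Q'' tr) < size tr)%N.
  have [] := hsel_argmax (Vlist a0 r gamma Q'' tr) isT.
  by rewrite size_map size_iota.
have := VgemS_dist Q Q' E tr (hsel (Vlist a0 r gamma Q tr)) QE E0.
have := VgemS_dist Q Q' E tr (hsel (Vlist a0 r gamma Q' tr)) QE E0.
have := le_Vgem_hstar Q tr _ (hsel_tr Q').
have := le_Vgem_hstar Q' tr _ (hsel_tr Q).
rewrite /target /gem_target /hstar -/V !ler_norml => h1 h2 /andP[? ?] /andP[? ?].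
by apply/andP; split; lra.
Qed.

Lemma target_le Q Q' B s a rest : let tr := (s, a) :: rest in
  complete_path tr -> 0 <= B -> (forall s a, Q' s a <= Qstar s a + B) ->
  target Q Q' tr <= Qstar s a + gamma * B.
Proof.
move=> tr path_tr B0 QB; rewrite (bellman_path _ _ _ path_tr).
rewrite /target /gem_target /hstar /= -addrA lerD2l -mulrDr.
case/andP: gamma01 => g0 _; rewrite ler_wpM2l//.
by apply: Vgem_le => //; case: path_tr.
Qed.

(** Horizon [1], the one-step backup, is always among the candidates, so the selected horizon is at
    least as good for [Q]; passing to [Q'] costs [gamma * E]. *)
Lemma target_ge Q Q' B E s a rest : let tr := (s, a) :: rest in
  complete_path tr -> (forall s a, Qstar s a - B <= Q s a) ->
  (forall s a, `|Q s a - Q' s a| <= E) -> 0 <= B ->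
  Qstar s a - gamma * B - gamma * E <= target Q Q' tr.
Proof.
move=> tr path_tr QB QE B0; case/andP: (gamma01) => g0 _.
have E0 : 0 <= E := le_trans (normr_ge0 _) (QE s a).
have := VgemS_dist Q Q' E tr (hsel (Vlist a0 r gamma Q tr)) QE E0.
have := le_Vgem_hstar Q tr 0 isT.
have V1 : Qstar s a - gamma * B <= V Q tr 1.
  rewrite (bellman_path _ _ _ path_tr) /V /= -addrA lerD2l -mulrBr ler_wpM2l//.
  case: rest {tr path_tr} => [|[s' a'] rest]; rewrite /V/=; first by rewrite add0r oppr_le0.
  by rewrite lerBlDr; apply: maxOverA_leD => a''; have := QB s' a''; lra.
rewrite /target /gem_target /hstar -/V ler_norml => h /andP[? ?].
by lra.
Qed.

End Targets.

(** * Law of one draw and of its coin *)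

Section Draws.
Context (R : realType) (S A : finType) (eps : R) (mu : S -> R).
Hypothesis mu_sum1 : \sum_s mu s = 1.

Lemma pdraw_ge0 (x : Draw S A) :
  0 < eps <= 1 -> (forall s, 0 <= mu s) -> 0 <= pdraw eps mu x.
Proof.
case/andP=> eps0 eps1 mu0; rewrite /pdraw !mulr_ge0// ?invr_ge0//.
by case: ifP => _; [exact: ltW|rewrite subr_ge0].
Qed.

(** The coin is a fair marginal of [pdraw]: the exploration weights, the uniform law on actions and
    the start law each sum to one, [a0] witnessing that [A] is inhabited. *)
Lemma pdraw_coin_sum (a0 : A) (F : bool -> R) :
  \sum_(x : Draw S A) pdraw eps mu x * F (d_coin x) = (F true + F false) / 2.
Proof.
have A0 : (#|A|%:R : R) != 0 by rewrite pnatr_eq0 -lt0n; apply/card_gt0P; exists a0.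
rewrite -(pair_bigA _ (fun e s => pdraw eps mu (e, s) * F e.2)) /=.
rewrite -(pair_bigA _ (fun e b => \sum_s pdraw eps mu ((e, b), s) * F b)) /=.
rewrite -(pair_bigA _ (fun e a => \sum_b \sum_s pdraw eps mu ((e, a, b), s) * F b)) /=.
under eq_bigr => e _ do under eq_bigr => a _ do under eq_bigr => b _ do
  [rewrite /pdraw /d_explore /d_start /=; under eq_bigr => s _ do rewrite mulrAC].
under eq_bigr => e _ do under eq_bigr => a _ do under eq_bigr => b _ do
  rewrite -mulr_sumr mu_sum1 mulr1.
under eq_bigr => e _ do rewrite sumr_const -[_ *+ _]mulr_natr.
rewrite big_bool /= !big_bool /=.
by field.
Qed.

End Draws.

(** * The run of the algorithm: adaptedness, recursion, invariants and boundedness *)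

Section Run.
Context (R : realType) (S A : finType) (a0 : A).
Context (f : S -> A -> option S) (r : S -> A -> R) (gamma : R).
Context (hsel : seq R -> nat) (gsel : (A -> R) -> A).
Context (start : seq (Draw S A) -> Draw S A -> S).
Context (tabrule : seq (Draw S A) -> Draw S A -> bool).
Context (alpha : seq (Draw S A) -> S -> A -> R).
Context (Q1init Q2init : S -> A -> R).

Let gem := run a0 f r gamma hsel gsel start tabrule alpha Q1init Q2init.
Let rate := eff_alpha a0 f r gamma hsel gsel start tabrule alpha Q1init Q2init.

(** Outside the update phase the list is empty, which makes [target_of] total; the effective rate is
    [0] there. *)
Definition suffix_of (c : cfg R S A) : seq (S * A) :=
  if cph c is Upd tr t then drop t tr else [::].

Definition table (t : bool) (c : cfg R S A) : S -> A -> R :=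
  if t then cQ1 c else cQ2 c.

Definition target_of (t : bool) (c : cfg R S A) : R :=
  gem_target a0 r gamma hsel (table t c) (table (~~ t) c) (suffix_of c).

Lemma run_ext u v n : (forall m, (m < n)%N -> u m = v m) -> gem u n = gem v n.
Proof.
elim: n => [//|n IHn] uv; rewrite /gem /= -/gem.
have uv' m : (m < n)%N -> u m = v m by move=> mn; apply: uv; exact: ltnW.
by rewrite -/(gem u n) -/(gem v n) IHn// uv//; congr step; apply/mkseq_eqP.
Qed.

Lemma eff_alpha_ext u v n : (forall m, (m < n)%N -> u m = v m) ->
  rate u n = rate v n.
Proof.
move=> uv; apply/funext => s; apply/funext => a.
rewrite /rate /eff_alpha -/(gem u n) -/(gem v n) (run_ext _ _ _ uv).
by have /mkseq_eqP -> := uv.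
Qed.

Lemma eff_alpha_suffix u n s a : rate u n s a != 0 ->
  exists rest, suffix_of (gem u n) = (s, a) :: rest.
Proof.
rewrite /rate /eff_alpha -/(gem u n) /suffix_of.
case: (cph _) => [|tr s' b|tr t]; rewrite ?eqxx//.
case: (drop t tr) => [|[s' a'] rest]; rewrite ?eqxx//.
by case: ifP => [/andP[/eqP-> /eqP->] _|]; [exists rest|rewrite eqxx].
Qed.

(** One recursion covers all phases: every tick counts as an update, with rate [0] for the entries
    and the table left alone. *)
Lemma tableS t u n s a : table t (gem u n.+1) s a = table t (gem u n) s a +
  (if d_coin (u n) == t then rate u n s a else 0) *
  (target_of t (gem u n) - table t (gem u n) s a).
Proof.
rewrite /gem /= -/gem -/(gem u n) /rate /eff_alpha -/(gem u n).
rewrite /target_of /suffix_of /step.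
case: (gem u n) => Q1 Q2 [|tr s' b|tr k] /=.
- by rewrite if_same mul0r addr0; case: t.
- by case: (f _ _) => [?|]; rewrite if_same mul0r addr0; case: t.
- case: (drop k tr) => [|[s' a'] rest].
    by rewrite if_same mul0r addr0; case: t.
  case: (d_coin (u n)); case: t => /=; rewrite ?mul0r ?addr0//.
  + rewrite /upd_at [s == s']eq_sym [a == a']eq_sym; case: ifP => [/andP[/eqP-> /eqP->]//|].
    by rewrite mul0r addr0.
  + rewrite /upd_at [s == s']eq_sym [a == a']eq_sym; case: ifP => [/andP[/eqP-> /eqP->]//|].
    by rewrite mul0r addr0.
Qed.

Let complete := complete_path S A f.

Lemma complete_path_drop t tr : complete tr -> complete (drop t tr).
Proof. by elim: tr t => [|[s a] tr IHtr] [|t] //= [_ /IHtr]. Qed.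

Lemma suffix_complete u n : complete (suffix_of (gem u n)).
Proof.
(* While acting, the trajectory is still unfinished; the invariant then says that any complete path
   from the current state completes it. *)
suff : match cph (gem u n) with
  | Begin => True
  | Act tr s _ => forall a rest, complete ((s, a) :: rest) ->
                    complete (tr ++ (s, a) :: rest)
  | Upd tr _ => complete tr end.
  rewrite /suffix_of; case: (cph _) => // tr t; exact: complete_path_drop.
elim: n => [//|n]; rewrite /gem /= -/gem -/(gem u n) /step.
case: (gem u n) => Q1 Q2 [|tr s b|tr t] //= IHn.
- set a := (if _ then _ else _).
  case fsa : (f s a) => [s'|] /=.
    move=> a' rest path_rest; rewrite cat_rcons; apply: IHn.
    by split; rewrite ?fsa.
  by rewrite -cats1; apply: IHn; split; rewrite ?fsa.
- case: (drop t tr) => [|[s a] rest] /=; first by case: ifP.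
  by case: (d_coin _) => /=; case: ifP.
Qed.

Context (C : R).
Hypothesis gamma01 : 0 <= gamma < 1.
Hypothesis alpha01 : forall h s a, 0 < alpha h s a < 1.
Hypothesis C_ge0 : 0 <= C.
Hypothesis Q1init_le : forall s a, `|Q1init s a| <= C.
Hypothesis Q2init_le : forall s a, `|Q2init s a| <= C.
Hypothesis r_le : forall s a, `|r s a| <= (1 - gamma) * C.

Lemma eff_alpha01 u n s a : 0 <= rate u n s a <= 1.
Proof.
rewrite /rate /eff_alpha; case: (cph _) => [|tr s' b|tr t]; rewrite ?lexx ?ler01//.
case: (drop t tr) => [|[s' a'] rest]; rewrite ?lexx ?ler01//.
case: ifP => _; rewrite ?lexx ?ler01//.
by have /andP[/ltW-> /ltW->] := alpha01 (mkseq u n) s a.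
Qed.

Lemma target_norm_le t c : (forall t s a, `|table t c s a| <= C) ->
  `|target_of t c| <= C.
Proof. by move=> tabC; apply: Vgem_norm_le. Qed.

(** Each update is a convex combination of the old entry and a target, both within [C]. *)
Lemma table_norm_le t u n s a : `|table t (gem u n) s a| <= C.
Proof.
elim: n t s a => [|n IHn] t s a; first by case: t.
rewrite tableS; set q := table _ _ _ _; set g := target_of _ _.
set x := (if _ then _ else _).
have /andP[x0 x1] : 0 <= x <= 1.
  by rewrite /x; case: ifP => _; rewrite ?lexx ?ler01// eff_alpha01.
have qC : `|q| <= C := IHn t s a.
have gC : `|g| <= C := target_norm_le t _ IHn.
have -> : q + x * (g - q) = (1 - x) * q + x * g by ring.
apply: le_trans (ler_normD _ _) _; rewrite !normrM (ger0_norm x0).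
rewrite ger0_norm ?subr_ge0//.
have := ler_wpM2l x0 gC; have : (1 - x) * `|q| <= (1 - x) * C by rewrite ler_wpM2l// subr_ge0.
by lra.
Qed.

End Run.

(** * Almost sure convergence of both tables *)

Theorem theorem2 (R : realType) (S A : finType) (a0 : A)
  (f : S -> A -> option S) (r : S -> A -> R) (gamma eps : R) (mu : S -> R)
  (hsel : seq R -> nat) (gsel : (A -> R) -> A)
  (start : seq (Draw S A) -> Draw S A -> S)
  (tabrule : seq (Draw S A) -> Draw S A -> bool)
  (alpha : seq (Draw S A) -> S -> A -> R)
  (Q1init Q2init : S -> A -> R) (Qstar : S -> A -> R)
  (d : measure_display) (T : measurableType d) (P : probability T R)
  (D : nat -> T -> Draw S A) :
  0 <= gamma < 1 ->
  0 < eps <= 1 ->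
  (forall s, 0 <= mu s) -> \sum_(s : S) mu s = 1 ->
  is_argmax_sel hsel -> is_greedy_sel gsel ->
  (forall s a, Qstar s a =
     r s a + gamma * (match f s a with
                      | Some s' => maxOverA a0 (Qstar s')
                      | None => 0 end)) ->
  (forall m x, measurable [set w | D m w = x]) ->
  (forall n (x : nat -> Draw S A),
     P [set w | forall m, (m < n)%N -> D m w = x m]
     = (\prod_(m < n) pdraw eps mu (x m))%:E) ->
  (forall h s a, 0 < alpha h s a < 1) ->
  {ae P, forall w, forall s a,
     let ds := fun m => D m w in
     (series (fun n => eff_alpha a0 f r gamma hsel gsel start tabrule alpha
                         Q1init Q2init ds n s a) @ \oo --> +oo)
     /\ exists l : R, (series (fun n => (eff_alpha a0 f r gamma hsel gsel start tabrule alpha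
                         Q1init Q2init ds n s a) ^+ 2) @ \oo --> l)} ->
  {ae P, forall w, forall s a,
     let ds := fun m => D m w in
     ((fun n => cQ1 (run a0 f r gamma hsel gsel start tabrule alpha
                       Q1init Q2init ds n) s a) @ \oo --> Qstar s a)
     /\ ((fun n => cQ2 (run a0 f r gamma hsel gsel start tabrule alpha
                       Q1init Q2init ds n) s a) @ \oo --> Qstar s a)}.
Proof.
move=> gamma01 eps01 mu_ge0 mu_sum1 hsel_argmax _ bellman mD law alpha01 rates.
have [s0 _] : exists s0 : S, true.
  apply/existsP; apply: contra_eqT mu_sum1 => /existsPn no_state.
  by rewrite big_pred0 1?eq_sym ?oner_eq0// => s; have := no_state s.
pose x0 : Draw S A := (true, a0, true, s0).
pose gem := run a0 f r gamma hsel gsel start tabrule alpha Q1init Q2init.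
pose rate := eff_alpha a0 f r gamma hsel gsel start tabrule alpha Q1init Q2init.
pose xi (x : Draw S A) : R := if d_coin x then 2^-1 else - 2^-1.
pose tab := table R S A.
pose G := target_of R S A a0 r gamma hsel.
pose noise u n s a := rate u n s a * (G true (gem u n) + G false (gem u n)
  - tab true (gem u n) s a - tab false (gem u n) s a).
have [C [C_ge0 Q1C Q2C rC]] : exists C, [/\ 0 <= C,
    (forall s a, `|Q1init s a| <= C), (forall s a, `|Q2init s a| <= C) &
    (forall s a, `|r s a| <= (1 - gamma) * C)].
  case/andP: gamma01 => g0 g1.
  have g1' : 0 < 1 - gamma by rewrite subr_gt0.
  (* The maximum of this sum of nonnegative terms dominates each of them; dividing by [1 - gamma]
     yields the bound on [r] that discounting preserves. *)
  pose F (k : S * A) :=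
    `|Q1init k.1 k.2| + `|Q2init k.1 k.2| + `|r k.1 k.2| / (1 - gamma).
  have r0 s a : 0 <= `|r s a| / (1 - gamma) by rewrite divr_ge0// ltW.
  have FC s a : F (s, a) <= \big[Order.max/0]_k F k by exact: le_bigmax.
  exists (\big[Order.max/0]_k F k); split.
  - by apply: le_trans (FC s0 a0); rewrite !addr_ge0.
  - by move=> s a; apply: le_trans (FC s a); rewrite /F/= -addrA lerDl addr_ge0.
  - by move=> s a; apply: le_trans (FC s a); rewrite /F/= addrAC lerDr addr_ge0.
  - move=> s a; rewrite mulrC -ler_pdivrMr//.
    by apply: le_trans (FC s a); rewrite /F/= lerDr addr_ge0.
have tabC t u n s a : `|tab t (gem u n) s a| <= C by exact: table_norm_le.
have GC t u n : `|G t (gem u n)| <= C.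
  by apply: target_norm_le => // t' s a; exact: tabC.
(* The centred coin takes the values plus and minus one half: mean zero, second moment [1 / 4]. *)
have transform (b : seq (Draw S A) -> R) : {ae P, forall w,
    cvgn (series (fun n => b (mkseq (D^~ w) n) ^+ 2)) ->
    cvgn (series (fun n => b (mkseq (D^~ w) n) * xi (D n w)))}.
  apply: (transform_cvg R (Draw S A) (pdraw eps mu) xi) => //.
  - by move=> x; exact: pdraw_ge0.
  - have := pdraw_coin_sum R S A eps mu mu_sum1 a0 (fun=> 1).
    by under eq_bigr do rewrite mulr1; move=> ->; field.
  - rewrite (pdraw_coin_sum R S A eps mu mu_sum1 a0 (fun b => if b then 2^-1 else - 2^-1)).
    by rewrite subrr mul0r.
  - rewrite (pdraw_coin_sum R S A eps mu mu_sum1 a0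
      (fun b => (if b then 2^-1 else - 2^-1) ^+ 2)).
    by lra.
(* [transform_cvg] takes coefficients on finite histories, whereas [rate] and [noise] take infinite
   sequences; padding a history with [x0] is harmless for an adapted process. *)
have prefix_ext (B : (nat -> Draw S A) -> nat -> S -> A -> R) :
  (forall u v n, (forall m, (m < n)%N -> u m = v m) -> B u n = B v n) ->
  forall u n s a,
    B (nth x0 (mkseq u n)) (size (mkseq u n)) s a = B u n s a.
  move=> B_ext u n s a; rewrite size_mkseq.
  by rewrite (B_ext (nth x0 (mkseq u n)) u)// => m mn; rewrite nth_mkseq.
have cvg_xi (B : (nat -> Draw S A) -> nat -> S -> A -> R) :
  (forall u v n, (forall m, (m < n)%N -> u m = v m) -> B u n = B v n) ->
  {ae P, forall w, forall k : S * A,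
    cvgn (series (fun n => B (D^~ w) n k.1 k.2 ^+ 2)) ->
    cvgn (series (fun n => B (D^~ w) n k.1 k.2 * xi (D n w)))}.
  move=> B_ext; apply: filter_forall => k.
  apply: filterS (transform (fun h => B (nth x0 h) (size h) k.1 k.2)) => w.
  have -> : (fun n => B (nth x0 (mkseq (D^~ w) n)) (size (mkseq (D^~ w) n)) k.1 k.2 ^+ 2)
    = (fun n => B (D^~ w) n k.1 k.2 ^+ 2).
    by apply/funext => n; rewrite prefix_ext.
  have -> // : (fun n => B (nth x0 (mkseq (D^~ w) n)) (size (mkseq (D^~ w) n)) k.1 k.2
      * xi (D n w)) = (fun n => B (D^~ w) n k.1 k.2 * xi (D n w)).
  by apply/funext => n; rewrite prefix_ext.
have rate_ext u v n : (forall m, (m < n)%N -> u m = v m) -> rate u n = rate v n.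
  exact: eff_alpha_ext.
have noise_ext u v n : (forall m, (m < n)%N -> u m = v m) -> noise u n = noise v n.
  move=> uv; rewrite /noise (rate_ext _ _ _ uv).
  suff -> : gem u n = gem v n by [].
  exact: run_ext.
apply: filterS3 rates (cvg_xi rate rate_ext) (cvg_xi noise noise_ext).
move=> w rates_w coin_cvg noise_cvg s a.
pose ds : nat -> Draw S A := D^~ w.
have suffix_path n : complete_path S A f (suffix_of R S A (gem ds n)).
  exact: suffix_complete.
suff tab_cvg t : tab t (gem ds n) s a @[n --> \oo] --> Qstar s a.
  by split; [exact: (tab_cvg true)|exact: (tab_cvg false)].
have sq_cvg (k : S * A) : cvgn (series (fun n => rate ds n k.1 k.2 ^+ 2)).
  by have [_ [l rl]] := rates_w k.1 k.2; apply/cvg_ex; exists l.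
apply: (double_iteration_cvg R (S * A)%type gamma C
  (fun n k => rate ds n k.1 k.2) (fun n => d_coin (ds n))
  (fun t n k => tab t (gem ds n) k.1 k.2) (fun t n => G t (gem ds n))
  (fun k => Qstar k.1 k.2) _ _ _ _ _ _ _ _ _ _ t (s, a)) => //=.
- by move=> n k; exact: eff_alpha01.
- by move=> t' n k; exact: tableS.
- move=> n k E /eff_alpha_suffix[rest suf_n] QE.
  rewrite /G /target_of suf_n; apply: target_dist => // s' a'.
  exact: (QE (s', a')).
- move=> t' n k B /eff_alpha_suffix[rest suf_n] B0 QB.
  have path_n := suffix_path n; rewrite /G /target_of suf_n in path_n *.
  by apply: (target_le R S A a0 f) => // s' a'; exact: (QB (s', a')).
- move=> t' n k B E /eff_alpha_suffix[rest suf_n] B0 QB QE.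
  have path_n := suffix_path n; rewrite /G /target_of suf_n in path_n *.
  apply: (target_ge R S A a0 f) => // s' a'; first exact: (QB (s', a')).
  by have := QE (s', a'); case: (t') => //=; rewrite distrC.
- by move=> k; have [] := rates_w k.1 k.2.
- by move=> k; exact: coin_cvg.
- move=> k; apply: noise_cvg.
  (* The bracket in [noise] has four terms bounded by [C], so its squares are summable along with
     those of the rates. *)
  apply: (@series_le_cvg _ _ (fun n => (4 * C) ^+ 2 * rate ds n k.1 k.2 ^+ 2)).
  + by move=> n; exact: sqr_ge0.
  + by move=> n; rewrite mulr_ge0 ?sqr_ge0.
  + move=> n; rewrite /noise exprMn mulrC ler_wpM2r ?sqr_ge0//.
    rewrite -[leLHS](real_normK (num_real _)) lerXn2r ?nnegrE ?mulr_ge0//.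
    have := tabC true ds n k.1 k.2; have := tabC false ds n k.1 k.2.
    have := GC true ds n; have := GC false ds n.
    rewrite !ler_norml => /andP[? ?] /andP[? ?] /andP[? ?] /andP[? ?].
    by apply/andP; split; lra.
  + exact: (@is_cvg_seriesZ _ _ ((4 * C) ^+ 2) (sq_cvg k)).
Qed.
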